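(* Let $k\geq 0$ be an integer and let $G$ be a graph of order $n\geq \max\{6k+17,\frac{(k+4)(k+5)}{2}\}$. If $$e(G)\geq\binom{n-k-2}{2}+\binom{k+3}{2},$$ then $G$ is weakly pancyclic with girth $3$. Suppose, in addition, that $G$ contains no cycle $C_{n-k}$. Then one of the following holds: (a) $G\subseteq F$ for some $F\in\mathcal{F}_{n,k+1}$; (b) $G\cong L_{n,k+2}= K_1\vee (K_{n-k-3}+K_{k+2})$; (c) $k=0$ and $G\subseteq\Gamma_{n,2}:=K_2\vee (K_{n-4}+2K_1)$; (d) $k=1$ and $G\cong\Gamma_{n,3}:=K_2\vee (K_{n-5}+3K_1)$.
   Context: A graph is weakly pancyclic if it contains cycles of every length from its girth (length of a shortest cycle) to its circumference (length of a longest cycle). For vertex-disjoint graphs $G_1,G_2$, $G_1+G_2$ denotes their disjoint union and $G_1\vee G_2$ their join (disjoint union plus all edges between $V(G_1)$ and $V(G_2)$); $tK_1$ denotes $t$ isolated vertices. For integers $k$ and $n\geq k+1$, $\mathcal{F}_{n,k}$ is the family of graphs $G$ of order $n$ that contain a complete subgraph $K\cong K_{n-k}$ such that for each component $H$ of $G-V(K)$, $V(H)$ is a clique of $G$ and there is a single vertex of $K$ to which all vertices of $H$ are adjacent (this vertex being the only neighbor of $H$ in $K$). $L_{n,k}:=K_1\vee(K_{n-k-1}+K_k)$, which is the member of $\mathcal{F}_{n,k}$ with the maximum number of edges. $e(G)$ is the number of edges. *)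

(* Defs.v *)
From mathcomp Require Import all_boot.

Set Implicit Arguments.
Unset Strict Implicit.
Unset Printing Implicit Defensive.

Record sgraph := SGraph {
  vertex :> finType;
  adj : rel vertex;
  adj_sym : symmetric adj;
  adj_irr : irreflexive adj }.

Definition gorder (G : sgraph) : nat := #|vertex G|.

Definition edges (G : sgraph) : {set {set G}} :=
  [set [set x; y] | x in G, y in G & adj x y].

Definition num_edges (G : sgraph) : nat := #|edges G|.

Definition isomorphic (G H : sgraph) : Prop :=
  exists2 f : G -> H, bijective f & forall x y, adj (f x) (f y) = adj x y.

(* Containment is up to isomorphism: the subgraph need be neither spanning nor
   induced. *)
Definition subgraph (G H : sgraph) : Prop :=
  exists2 f : G -> H, injective f & forall x y, adj x y -> adj (f x) (f y).

Section Complete.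
Variable n : nat.
Definition complete_adj : rel 'I_n := fun i j => i != j.
Lemma complete_sym : symmetric complete_adj.
Proof. by move=> i j; rewrite /complete_adj eq_sym. Qed.
Lemma complete_irr : irreflexive complete_adj.
Proof. by move=> i; rewrite /complete_adj eqxx. Qed.
Definition complete : sgraph := SGraph complete_sym complete_irr.
End Complete.

Section Edgeless.
Variable t : nat.
Definition edgeless_adj : rel 'I_t := fun _ _ => false.
Lemma edgeless_sym : symmetric edgeless_adj. Proof. by []. Qed.
Lemma edgeless_irr : irreflexive edgeless_adj. Proof. by []. Qed.
Definition edgeless : sgraph := SGraph edgeless_sym edgeless_irr.
End Edgeless.

Section Sums.
Variables G H : sgraph.

(* [b] tells whether the edges between the two sides are present. *)
Definition sum_adj (b : bool) : rel (G + H) := fun u v =>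
  match u, v with
  | inl x, inl y => adj x y
  | inr x, inr y => adj x y
  | _, _ => b
  end.
Lemma sum_sym b : symmetric (sum_adj b).
Proof. by move=> [x|x] [y|y] //=; rewrite adj_sym. Qed.
Lemma sum_irr b : irreflexive (sum_adj b).
Proof. by move=> [x|x] /=; rewrite adj_irr. Qed.

Definition disjoint_union : sgraph := SGraph (sum_sym false) (sum_irr false).
Definition join : sgraph := SGraph (sum_sym true) (sum_irr true).
End Sums.

Section Induced.
Variables (G : sgraph) (A : {set G}).
Definition induced_adj : rel {x : G | x \in A} := fun u v => adj (val u) (val v).
Lemma induced_sym : symmetric induced_adj.
Proof. by move=> u v; rewrite /induced_adj adj_sym. Qed.
Lemma induced_irr : irreflexive induced_adj.
Proof. by move=> u; rewrite /induced_adj adj_irr. Qed.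
Definition induced : sgraph := SGraph induced_sym induced_irr.
End Induced.

Definition clique (G : sgraph) (A : {set G}) : Prop :=
  {in A &, forall x y, x != y -> adj x y}.

Definition components (G : sgraph) : {set {set G}} :=
  [set [set y | connect (@adj G) x y] | x in G].

(* The components of G - S, as sets of vertices of G. *)
Definition components_off (G : sgraph) (S : {set G}) : {set {set G}} :=
  [set [set val x | x in (C : {set induced (~: S)})]
     | C in components (induced (~: S))].

(* The family F_{n,k}, intended for k < n: S is the vertex set of K, and v is
   the only neighbour in S of each vertex of C. *)
Definition in_F (n k : nat) (G : sgraph) : Prop :=
  gorder G = n /\
  exists S : {set G},
    [/\ #|S| = n - k,
        clique S
      & forall C : {set G}, C \in components_off S ->
          clique C /\
          (exists2 v, v \in S &
             forall x, x \in C -> forall u, u \in S -> adj x u = (u == v))].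

Definition L (n k : nat) : sgraph :=
  join (complete 1) (disjoint_union (complete (n - k - 1)) (complete k)).

Definition Gamma (n s : nat) : sgraph :=
  join (complete 2) (disjoint_union (complete (n - s - 2)) (edgeless s)).

(* [ucycle] also accepts the empty sequence and an edge traversed back and
   forth, hence the lower bound on [m]. *)
Definition has_cycle (G : sgraph) (m : nat) : Prop :=
  3 <= m /\ exists2 c : seq G, size c = m & ucycle (@adj G) c.

Definition is_girth (G : sgraph) (g : nat) : Prop :=
  has_cycle G g /\ forall m, has_cycle G m -> g <= m.

Definition is_circumference (G : sgraph) (c : nat) : Prop :=
  has_cycle G c /\ forall m, has_cycle G m -> m <= c.

(* Holds vacuously for forests, which have neither girth nor circumference. *)
Definition weakly_pancyclic (G : sgraph) : Prop :=
  forall g c, is_girth G g -> is_circumference G c ->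
  forall m, g <= m <= c -> has_cycle G m.

(* Main.v *)
Require Import Defs.
From mathcomp Require Import all_boot.
From mathcomp Require Import zify.

Set Implicit Arguments.
Unset Strict Implicit.
Unset Printing Implicit Defensive.

(** Write m = k + 2, so that the edge bound reads
    2 e(G) >= (n - m)(n - m - 1) + m(m + 1).  The Bondy-Chvatal closure of G
    (joining non-adjacent vertices of degree sum at least n, repeatedly) has
    the same circumference as G.  In the closure the vertices of degree at
    least n/2 form a clique K, a vertex outside K has degree at most n - |K|,
    and the edge bound then forces n - |K| <= m.  Hence G has a cycle of length
    at least n - m; the subgraph induced on any such cycle of length s is
    Hamiltonian with more than s^2/4 edges, hence pancyclic by Bondy's argument.

    If there is no C_{n-k}, no cycle of the closure is that long, so K has n-k-1
    or n-k-2 vertices.  A path through the complement of K joining two vertices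
    of K extends to a cycle containing K.  For |K| = n-k-1 there is no such path,
    which is (a).  For |K| = n-k-2 such a path has a single interior vertex;
    let W be the set of vertices outside K with two neighbours in K.  If W is
    empty, equality in the edge bound gives (b); if W is a singleton, adding it
    to K gives (a); otherwise all vertices of W have the same two neighbours in
    K, and counting edges leaves only (c) and (d). *)

(** * Degrees into vertex sets and their sums *)

Section Cycles.
Variable T : finType.
Implicit Types (e : rel T) (A B : {set T}) (c p q : seq T).

Definition degin e A x := #|[set y in A | e x y]|.
Definition deg e x := degin e setT x.

Lemma degin_le_card e A x : degin e A x <= #|A|.
Proof. by apply/subset_leq_card/subsetP => y; rewrite inE => /andP[]. Qed.

Lemma degin_mono e e' A B x :
  subrel e e' -> A \subset B -> degin e A x <= degin e' B x.
Proof.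
move=> ee' /subsetP AB; apply/subset_leq_card/subsetP => y.
by rewrite !inE => /andP[/AB-> /ee'].
Qed.

Lemma deginU e A B x :
  [disjoint A & B] -> degin e (A :|: B) x = degin e A x + degin e B x.
Proof.
move=> AB; rewrite /degin -cardsUI.
rewrite (_ : _ :&: _ = set0) ?cards0 ?addn0; last first.
  apply/setP => y; rewrite !inE; case: (boolP (y \in A)) => //= yA.
  by rewrite (disjointFr AB yA) andbF.
by congr #|pred_of_set _|; apply/setP => y; rewrite !inE andb_orl.
Qed.

Lemma deginC e A x : deg e x = degin e A x + degin e (~: A) x.
Proof. by rewrite -deginU ?setUCr // -setI_eq0 setICr. Qed.

Lemma degin_sumE e A x : degin e A x = \sum_(y in A) e x y.
Proof.
rewrite /degin -sum1_card big_mkcond [RHS]big_mkcond.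
by apply: eq_bigr => y _; rewrite inE; case: (y \in A); case: (e x y).
Qed.

Lemma sum_degin_exchange e A B : symmetric e ->
  \sum_(x in A) degin e B x = \sum_(y in B) degin e A y.
Proof.
move=> es; under eq_bigr do rewrite degin_sumE.
rewrite exchange_big; apply: eq_bigr => y _; rewrite degin_sumE.
by apply: eq_bigr => x _; rewrite es.
Qed.

Lemma degin_nonadj e A x y : irreflexive e -> x \in A -> y \in A -> ~~ e x y ->
  x != y -> degin e A x <= #|A| - 2.
Proof.
move=> ei xA yA nexy xy.
have -> : #|A| - 2 = #|A :\: [set x; y]|.
  rewrite cardsD (setIidPr _) ?cards2 ?xy //.
  by apply/subsetP => z; rewrite !inE => /orP[]/eqP->.
apply/subset_leq_card/subsetP => z; rewrite !inE => /andP[-> exz]; rewrite andbT.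
by apply/negP => /orP[]/eqP zE; move: exz; rewrite zE ?ei // (negbTE nexy).
Qed.

Lemma degin_le e A x : irreflexive e -> x \in A -> degin e A x <= #|A| - 1.
Proof.
move=> ei xA; have -> : #|A| - 1 = #|A :\ x| by rewrite (cardsD1 x A) xA; lia.
apply/subset_leq_card/subsetP => z; rewrite !inE => /andP[-> exz]; rewrite andbT.
by apply: contraTneq exz => ->; rewrite ei.
Qed.

(** An edge between [A] and its complement is seen from both ends, hence the factor 2 at its outer
    end. *)
Lemma sum_deg_clique e A : symmetric e -> irreflexive e ->
  {in A &, forall x y, x != y -> e x y} ->
  \sum_x deg e x = #|A| * (#|A| - 1)
    + \sum_(x in ~: A) (2 * degin e A x + degin e (~: A) x).
Proof.
move=> es ei Acl; under eq_bigr do rewrite (deginC _ A).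
rewrite (bigID (mem A)) /= 2![in LHS]big_split /=.
rewrite (eq_bigr (fun=> #|A| - 1)) => [|x xA]; last first.
  have -> : degin e A x = #|A :\ x|.
    congr #|pred_of_set _|; apply/setP => y; rewrite !inE andbC.
    case: (boolP (y \in A)) => yA; rewrite ?andbF ?andbT //.
    case: eqVneq => [->|yx] //=.
    by apply: Acl => //; rewrite eq_sym.
  by rewrite (cardsD1 x A) xA; lia.
rewrite sum_nat_const sum_degin_exchange // big_split /= -big_distrr /=.
have notinE F : \sum_(x | x \notin A) F x = \sum_(x in ~: A) F x :> nat.
  by apply: eq_bigl => x; rewrite inE.
by rewrite !notinE; lia.
Qed.

(** * Long cycles and the Bondy-Chvatal closure *)

Definition has_cycle_geq e s := exists2 c, ucycle e c & s <= size c.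

Definition add_edge e u v : rel T :=
  fun x y => [|| e x y, (x == u) && (y == v) | (x == v) && (y == u)].

(* [next c] fixes the vertices off [c], so a single pigeonhole yields either a
   common neighbour of [x] and [y] off the path or a pair of crossing chords. *)
Lemma crossing_cycle e y p x : symmetric e -> irreflexive e ->
  path e y (rcons p x) -> uniq (y :: rcons p x) -> #|T| <= deg e y + deg e x ->
  has_cycle_geq e (size p).+2.
Proof.
move=> es ei; set c := y :: rcons p x => pe cu dxy.
have nx : next c x = y.
  by have := cycle_next cu; rewrite /c /= rcons_path last_rcons => /andP[_ /eqP].
have [w /andP[e1 e2]] : exists w, e y (next c w) && e x w.
  apply/existsP; apply: contraTT dxy; rewrite negb_exists => /forallP H.
  rewrite -ltnNge.
  rewrite /deg /degin -(card_preimset _ (can_inj (prev_next cu))) -cardsUI.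
  rewrite (_ : _ :&: _ = set0); last first.
    by apply/setP => w; rewrite !inE; apply/negbTE/H.
  (* The union of the two sets misses [x], because [next c x] is [y] and [e] has no loops; so the
     degree sum is below [#|T|]. *)
  rewrite cards0 addn0 -cardsT; apply/proper_card/properP; split=> //.
  by exists x; rewrite // !inE nx !ei.
case: (boolP (w \in c)) => wc; last first.
  exists (w :: c); last by rewrite /= size_rcons; lia.
  rewrite /ucycle cons_uniq wc cu andbT /= rcons_path pe last_rcons e2 andbT.
  by move: e1; rewrite next_nth (negbTE wc) es => ->.
have wyp : w \in y :: p.
  move: wc; rewrite /c -rcons_cons mem_rcons inE => /orP[/eqP wx|//].
  by move: e2; rewrite wx ei.
have [p1 [z [q cE]]] : exists p1 z q, c = p1 ++ w :: z :: q.
  rewrite /c -rcons_cons; case/splitPr: wyp => p1 p2.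
  by exists p1; case: p2 => [|z q]; [exists x, [::] | exists z, (rcons q x)];
    rewrite rcons_cat.
have nwz : next c w = z.
  have := cycle_next cu; rewrite -(rot_cycle (size p1)) {2}cE rot_size_cat /=.
  by case/andP=> /eqP.
rewrite {}nwz in e1.
have [s1 s1E] : exists s1, rcons p1 w = y :: s1.
  by move: cE; case: (p1) => [|a p1'] [<- _]; eexists.
have lx : last z q = x.
  by have := congr1 (last y) cE; rewrite /c last_cat /= last_rcons.
have cE' : c = (y :: s1) ++ z :: q by rewrite -s1E cat_rcons.
(* The new cycle runs from [y] to [w], crosses to [x], and returns backwards to [z], which is
   adjacent to [y]. *)
exists ((y :: s1) ++ rev (z :: q)); last first.
  by rewrite size_cat size_rev -size_cat -cE' /= size_rcons.
rewrite /ucycle; apply/andP; split; last first.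
  suff -> : uniq ((y :: s1) ++ rev (z :: q)) = uniq c by [].
  by apply: perm_uniq; rewrite cE' perm_cat2l perm_rev.
have lw : last y s1 = w by rewrite -(last_rcons w p1 w) s1E.
move: pe; rewrite /c in cE'; case: cE' => ->; rewrite cat_path /= => /and3P[p1e _ p2e].
rewrite rcons_cat cat_path p1e lw -rev_cons /=.
have -> : w = last y (rcons (z :: q) w) by rewrite last_rcons.
have -> : y :: z :: q = belast y (rcons (z :: q) w) by rewrite belast_rcons.
rewrite rev_path; under eq_path do rewrite es.
by rewrite rcons_path /= e1 p2e lx e2.
Qed.

Lemma add_edge_sym e u v : symmetric e -> symmetric (add_edge e u v).
Proof.
by move=> es x y; rewrite /add_edge es; case: (x == u); case: (y == v);
  case: (x == v); case: (y == u); rewrite ?orbT ?orbF.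
Qed.

(** Deleting the added edge from a cycle that uses it leaves a path between [u] and [v] on the same
    vertices, to which [crossing_cycle] applies. The bound [2 < s] discards the degenerate sequences
    that [ucycle] accepts. *)
Lemma add_edge_has_cycle e u v s : symmetric e -> irreflexive e -> u != v ->
  #|T| <= deg e u + deg e v -> 2 < s -> has_cycle_geq (add_edge e u v) s -> has_cycle_geq e s.
Proof.
move=> es ei uv duv s3 [c /andP[cc cu] sc].
case: (boolP (cycle e c)) => [ce|nce]; first by exists c; rewrite // /ucycle ce.
have [x xc nex] : exists2 x, x \in c & ~~ e x (next c x).
  apply/exists_inP; apply: contraR nce => /exists_inPn H.
  by apply: cycle_from_next => // x /H /negPn.
case: (rot_to xc) => i [|y [|z p]] cE.
- by have := leq_trans s3 sc; rewrite -(size_rot i) cE.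
- by have := leq_trans s3 sc; rewrite -(size_rot i) cE.
have sz : size c = (size p).+3 by rewrite -(size_rot i) cE.
have nexy : ~~ e x y by move: nex; rewrite -(next_rot i cu) cE /= eqxx.
rewrite -(rot_cycle i) cE in cc; rewrite -(rot_uniq i) cE in cu.
have [xy pe] : add_edge e u v x y /\ path (add_edge e u v) y (rcons (z :: p) x).
  by move: cc; rewrite /= => /andP[].
have uq : uniq (y :: rcons (z :: p) x).
  by rewrite -rcons_cons rcons_uniq -cons_uniq.
have sub : forall a b, a != y -> b != y -> add_edge e u v a b -> e a b.
  move=> a b; move: xy; rewrite /add_edge (negbTE nexy) /=.
  by case/orP=> /andP[/eqP<- /eqP<-] /negbTE ay /negbTE bY; rewrite ay bY ?andbF ?orbF.
have [xNy xNz yNz] : [/\ x != y, x != z & y != z].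
  by move: cu; rewrite /= !inE !negb_or => /and3P[/and3P[-> -> _] /andP[-> _] _].
case: (@crossing_cycle e y (z :: p) x) => //=.
- move: pe; rewrite /= => /andP[yz pe]; apply/andP; split.
    move: yz xy; rewrite /add_edge (negbTE nexy) /=; case: (e y z) => //=.
    move=> /orP[]/andP[/eqP yE /eqP zE] /orP[]/andP[/eqP xE /eqP yE'].
    - by rewrite -yE -yE' eqxx in uv.
    - by rewrite xE zE eqxx in xNz.
    - by rewrite xE zE eqxx in xNz.
    - by rewrite -yE -yE' eqxx in uv.
  apply: (sub_in_path (P := fun a => a != y)) pe => [a b /= ay bY|]; first exact: sub.
  apply/allP => a aP; apply: contraTneq uq => <-.
  by rewrite /= -cons_uniq /= in aP *; rewrite -rcons_cons in aP *; rewrite aP.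
- move: xy; rewrite /add_edge (negbTE nexy) /= => /orP[]/andP[/eqP-> /eqP->] //.
  by rewrite addnC.
- by move=> c' uc' sc'; exists c' => //; apply: leq_trans sc'; rewrite -sz.
Qed.

(** The graph equals its own Bondy-Chvatal closure. *)
Definition nclosed e := forall u v, u != v -> #|T| <= deg e u + deg e v -> e u v.

Lemma closure_exists e : symmetric e -> irreflexive e ->
  exists e', [/\ symmetric e', irreflexive e', subrel e e', nclosed e' &
    forall s, 2 < s -> has_cycle_geq e' s -> has_cycle_geq e s].
Proof.
have [N] := ubnP #|[set p : T * T | ~~ e p.1 p.2]|.
elim: N e => // N IH e leN es ei.
case: (boolP [exists u, exists v, [&& u != v, #|T| <= deg e u + deg e v & ~~ e u v]]).
  case/existsP=> u /existsP[v /and3P[uv duv nuv]].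
  have ee' : subrel e (add_edge e u v) by move=> x y exy; apply/orP; left.
  case: (IH (add_edge e u v)).
  - rewrite ltnS in leN; apply: leq_trans leN; apply/proper_card/properP; split.
      by apply/subsetP => p; rewrite !inE; apply: contra; apply: ee'.
    by exists (u, v); rewrite !inE //= /add_edge !eqxx orbT.
  - exact: add_edge_sym.
  - move=> x; rewrite /add_edge ei /=; apply/negP => /orP[]/andP[/eqP xu /eqP xv];
      by move: uv; rewrite -xu -xv eqxx.
  - move=> e' [e's e'i e'e e'c He']; exists e'; split=> //.
      by move=> x y /ee' /e'e.
    by move=> s s3 /He' - /(_ s3); apply: add_edge_has_cycle.
rewrite negb_exists => /forallP H; exists e; split=> // u v uv duv.
by move: (H u); rewrite negb_exists => /forallP /(_ v); rewrite uv duv /= negbK.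
Qed.

(** * Bondy's pancyclicity argument *)

Lemma count_nth_ord (x0 : T) (P : pred T) q :
  count P q = #|[set j : 'I_(size q) | P (nth x0 q j)]|.
Proof.
rewrite -sum1_count (big_nth x0) big_mkord -sum1_card.
by apply: eq_bigl => j; rewrite inE.
Qed.

(** Shifting [Q] back by [a] places keeps its size, so it must meet [P]. *)
Lemma rotation_pigeonhole N a (P Q : {set 'I_N}) : N < #|P| + #|Q| ->
  exists j j' : 'I_N, [/\ j \in P, j' \in Q & j' = (j + a) %% N :> nat].
Proof.
move=> NPQ; have N0 : 0 < N.
  case: N P Q NPQ => // P Q; have := max_card P; have := max_card Q.
  by rewrite card_ord; lia.
pose f (j : 'I_N) := Ordinal (ltn_pmod (j + a) N0).
have fi : injective f.
  move=> i j /(congr1 val) /= /eqP; rewrite eqn_modDr !modn_small // => /eqP.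
  exact: val_inj.
have /set0Pn[j] : P :&: f @^-1: Q != set0.
  apply: contraTneq NPQ => PQ0; rewrite -leqNgt -(card_preimset Q fi) -cardsUI PQ0.
  by rewrite cards0 addn0; have := max_card (P :|: f @^-1: Q); rewrite card_ord.
by rewrite !inE => /andP[Pj Qj]; exists j, (f j).
Qed.

(* If [y] sees the [j]-th vertex of [q] and [x] the one [l - 3] steps further
   (cyclically in [q]), then these two chords close up a cycle of length [l]. *)
Lemma bondy_edge e y q x l : symmetric e -> irreflexive e ->
  path e y (rcons q x) -> uniq (y :: rcons q x) -> e x y ->
  (size q).+2 < count (e y) (y :: rcons q x) + count (e x) (y :: rcons q x) ->
  2 < l <= (size q).+2 -> exists2 c, ucycle e c & size c = l.
Proof.
move=> es ei pe uq exy; rewrite /= -cats1 !count_cat /= !ei exy (es y) exy /= => dd.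
case/andP=> l3; rewrite leq_eqVlt => /orP[/eqP-> |lq].
  exists (y :: rcons q x); rewrite /= ?size_rcons // /ucycle uq andbT /=.
  by rewrite rcons_path pe last_rcons.
pose a := l - 3; have lE : l = a + 3 by rewrite /a; lia.
have [|j [j' []]] := @rotation_pigeonhole (size q) a
    [set j : 'I_(size q) | e y (nth y q j)] [set j : 'I_(size q) | e x (nth y q j)].
  by rewrite -!(count_nth_ord y (e _)); lia.
rewrite !inE; move: (ltn_ord j) (ltn_ord j').
move: (nat_of_ord j) (nat_of_ord j') => {}j {}j' jq jq' yj xj' j'E.
have qjE : drop j q = nth y q j :: drop j.+1 q by rewrite (drop_nth y).
have [ja|ja] := ltnP (j + a) (size q).
  rewrite modn_small // in j'E.
  pose s := take a (drop j.+1 q).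
  have ss : size s = a by rewrite size_takel // size_drop; lia.
  have ls : last (nth y q j) s = nth y q j'.
    rewrite j'E (last_nth y) ss -[_ :: s]/(take a.+1 (nth y q j :: drop j.+1 q)) -qjE.
    by rewrite nth_take // nth_drop.
  (* Without wrap-around: [y], the stretch of [q] from [j] to [j + a], then [x]; this has [a + 3]
     vertices. *)
  exists (y :: rcons (nth y q j :: s) x); last by rewrite /= size_rcons ss; lia.
  rewrite /ucycle; apply/andP; split.
    rewrite /= yj rcons_path last_rcons rcons_path ls exy andbT.
    rewrite es xj' andbT.
    move: pe; rewrite -{1}(cat_take_drop j q) qjE.
    rewrite -{1}(cat_take_drop a (drop j.+1 q)) -/s.
    by rewrite rcons_cat cat_path /= rcons_cat cat_path => /and4P[_ _ ->].
  apply: subseq_uniq uq.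
  suff : subseq (rcons (nth y q j :: s) x) (rcons q x) by move=> H; rewrite /= eqxx.
  rewrite -!cats1; apply: cat_subseq => //.
  have := drop_subseq q j; rewrite qjE; apply: subseq_trans => /=.
  by rewrite eqxx take_subseq.
have iE : j' = j + a - size q :> nat.
  rewrite j'E -{1}(subnK ja) modnDr modn_small //; lia.
pose s := take j'.+1 q; pose t := drop j q.
have ij : j' < j by lia.
have ls : last y s = nth y q j'.
  by rewrite /s (take_nth y) ?last_rcons.
(* With wrap-around: from [y] along [q] up to [j'], over to [x], then backwards along [q] from its
   end to [j], and back to [y]. *)
exists (y :: s ++ x :: rev t); last first.
  by rewrite /= size_cat /= size_rev size_drop size_takel; lia.
rewrite /ucycle; apply/andP; split.
  rewrite /= rcons_cat cat_path /= ls (es _ x) xj' -rev_cons.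
  have -> : x = last y (rcons t x) by rewrite last_rcons.
  have -> : y :: t = belast y (rcons t x) by rewrite belast_rcons.
  rewrite rev_path; under [path _ _ (rcons _ _)]eq_path do rewrite es.
  apply/and3P; split=> //.
    by move: pe; rewrite -(cat_take_drop j'.+1 q) rcons_cat cat_path => /andP[].
  move: pe; rewrite -{1}(cat_take_drop j q) rcons_cat cat_path /t qjE /= => /and3P[_ _ ->].
  by rewrite yj.
have /perm_uniq-> : perm_eq (y :: s ++ x :: rev t) (y :: rcons (s ++ t) x).
  rewrite perm_cons -cats1 -catA perm_cat2l -cat1s perm_catC perm_cat2r.
  by rewrite perm_rev.
apply: subseq_uniq uq; rewrite /= eqxx -!cats1; apply: cat_subseq => //.
rewrite -(cat_take_drop j'.+1 q); apply: cat_subseq => //.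
by rewrite /t -(subnK ij) -drop_drop drop_subseq.
Qed.

(** Averaging [degin e A x + degin e A (next c x)] over the cycle yields consecutive vertices with
    degree sum above [size c], and [bondy_edge] applies to them. *)
Lemma pancyclic_of_degree_sum e c l : symmetric e -> irreflexive e -> ucycle e c ->
  let A := [set z in c] in
  size c ^ 2 < 2 * \sum_(x in A) degin e A x ->
  2 < l <= size c -> exists2 c', ucycle e c' & size c' = l.
Proof.
move=> es ei /andP[cc cu] A dA lc.
have cA : #|A| = size c by rewrite cardsE; apply/card_uniqP.
have dE x : degin e A x = count (e x) c.
  rewrite -size_filter -(card_uniqP (filter_uniq (e x) cu)).
  by apply: eq_card => z; rewrite !inE mem_filter andbC.
have [x xA dx] : exists2 x, x \in A & size c < degin e A x + degin e A (next c x).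
  apply/exists_inP; apply: contraTT dA => /exists_inPn H; rewrite -leqNgt.
  have sE : \sum_(x in A) degin e A (next c x) = \sum_(x in A) degin e A x.
    rewrite [RHS](reindex_inj (can_inj (prev_next cu))) /=.
    by apply: eq_bigl => x; rewrite !inE mem_next.
  rewrite mul2n -addnn -{2}sE -big_split /=.
  rewrite -[size c ^ 2]/(size c * size c) -{1}cA -sum_nat_const.
  by apply: leq_sum => x /H; rewrite -leqNgt.
move: xA; rewrite inE => xc; case: (rot_to xc) => i [|y q] cE.
  by case/andP: lc => l3 /(leq_trans l3); rewrite -(size_rot i) cE.
have yE : next c x = y by rewrite -(next_rot i cu) cE /= eqxx.
have sz : size c = (size q).+2 by rewrite -(size_rot i) cE.
have pm : perm_eq c (y :: rcons q x).
  rewrite -rcons_cons perm_sym perm_rcons -cE perm_rot //.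
rewrite -(rot_cycle i) cE /= in cc; case/andP: cc => exy pe.
apply: (@bondy_edge e y q x) => //.
- by rewrite -(perm_uniq pm).
- by rewrite -!(permP pm) -!dE -sz addnC -yE.
- by rewrite -sz.
Qed.

(* A path between two vertices of a clique is closed up through the vertices
   of the clique that it misses. *)
Lemma clique_cycle e A x p : symmetric e ->
  {in A &, forall x y, x != y -> e x y} ->
  x \in A -> last x p \in A -> path e x p -> uniq (x :: p) -> 0 < size p ->
  has_cycle_geq e (#|A| + count [predC A] p).
Proof.
move=> es Acl xA lA pe uq p0.
pose R := enum [set z in A | z \notin x :: p].
have RA z : z \in R -> z \in A /\ z \notin x :: p by rewrite mem_enum !inE => /andP.
exists (x :: p ++ R).
  rewrite /ucycle; apply/andP; split.
    rewrite /= rcons_cat cat_path pe /=.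
    have : last x p != x.
      case/lastP: p p0 uq {lA pe R RA} => // p y _; rewrite last_rcons /= mem_rcons inE.
      by rewrite eq_sym negb_or => /andP[/andP[]].
    have : last x p \notin R.
      by apply/negP => /RA[_]; rewrite mem_last.
    have : uniq R by exact: enum_uniq.
    have : {in R, forall z, z \in A /\ z != x}.
      by move=> z /RA[-> ]; rewrite inE negb_or => /andP[].
    elim: R (last x p) lA {RA} => [|z R IH] w wA RA uR wR wx /=.
      by rewrite Acl.
    have [zA zx] := RA _ (mem_head _ _).
    rewrite Acl //=; last by apply: contraNneq wR => ->; rewrite mem_head.
    move: uR => /= /andP[zR uR]; apply: IH => //.
    by move=> z' z'R; apply: RA; rewrite inE z'R orbT.
  by rewrite -cat_cons cat_uniq uq enum_uniq /= andbT; apply/hasPn => z /RA[_ //].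
have cR : #|A| = #|[set z in A | z \in x :: p]| + size R.
  rewrite -cardE -cardsUI (_ : _ :&: _ = set0) ?cards0 ?addn0; last first.
    by apply/setP => z; rewrite !inE; case: (z \in A) => //=; case: (_ || _).
  apply: eq_card => z; rewrite !inE.
  by case: (z \in A); case: (z == x); case: (z \in p).
have cA : #|A| = size R + (count (mem A) p).+1.
  rewrite cR addnC; congr (_ + _).
  have -> : (count (mem A) p).+1 = count (mem A) (x :: p) by rewrite /= xA.
  rewrite -size_filter -(card_uniqP (filter_uniq _ uq)).
  by apply: eq_card => z; rewrite !inE mem_filter !inE.
by rewrite cA /= size_cat -[size p](count_predC (mem A)) addnS addSn ltnS -addnA addnC.
Qed.

End Cycles.

(** * Arithmetic of the edge bound *)

Lemma order_bound m n : 6 * m + 5 <= n -> (m + 2) * (m + 3) <= 2 * n ->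
  8 * m * (n - m - 1) < n * n - 1.
Proof.
move=> n1 n2; have [t nE] : exists t, n = 4 * m + t by exists (n - 4 * m); lia.
have t1 : 2 * m + 5 <= t by lia.
have t2 : m * m + 6 <= 2 * t + 3 * m by lia.
have sq (x y : nat) : x <= y -> x * x <= y * y by move=> xy; apply: leq_mul.
(* Substituting [n = 4 * m + t] leaves this inequality. It follows from [t2] for [m >= 14] and from
   [t1] for [m <= 7]; the six values in between are checked one at a time. *)
suff ineq : 8 * (m * m) + 1 < t * t + 8 * m.
  rewrite nE; have [w wE] : exists w, 3 * m + t = w + 1 by exists (3 * m + t - 1); lia.
  rewrite (_ : 4 * m + t - m - 1 = w); last by lia.
  by have := congr1 (muln m) wE; lia.
have [m14|m14] := leqP 14 m.
  have m2 : 14 * m <= m * m by rewrite leq_mul2r m14 orbT.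
  by have := sq (5 * m) t; lia.
have := sq _ _ t1.
have [m7|m7] := leqP m 7.
  have : m * m <= 7 * m by rewrite leq_mul2r m7 orbT.
  lia.
have := sq ((m * m + 6 - 3 * m) %/ 2) t.
by do 14 (destruct m as [|m]; first by lia); lia.
Qed.

(** Here [r] counts vertices of degree at most [(n - 1) / 2]. If [2 * r] exceeded [n], then [4 * S]
    would be at most [(3 * n - 1) * (n - 1)], which [order_bound] shows to be too small. *)
Lemma low_count_half m n r S : 6 * m + 5 <= n -> (m + 2) * (m + 3) <= 2 * n ->
  r <= n -> (n - m) * (n - m - 1) + m * (m + 1) <= S ->
  2 * S <= 2 * ((n - r) * (n - 1)) + r * (n - 1) -> 2 * r <= n.
Proof.
move=> n1 n2 rn D H; have key := order_bound n1 n2.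
rewrite leqNgt; apply/negP => nr.
have [w nE] : exists w, n = m + w + 1 by exists (n - m - 1); lia.
have E1 : n - m = w + 1 by lia.
have E2 : n - 1 = m + w by lia.
rewrite E1 E2 addnK in D H key.
have : 2 * (2 * (n - r) + r) * (m + w) <= (3 * (m + w) + 2) * (m + w).
  by rewrite leq_mul2r; apply/orP; right; lia.
by move: (n - r) H => t H; rewrite nE in key; lia.
Qed.

(* With [r] vertices of low degree, the two bounds on the degree sum come from low
   degrees at most [r], respectively at most [(n - 1) / 2].  The first is convex in
   [r], so it excludes [m < r < n / 2] by its values at the two ends; the second
   excludes [r = n / 2]. *)
Lemma low_count_bound m n r : 6 * m + 5 <= n -> (m + 2) * (m + 3) <= 2 * n ->
  2 * r <= n ->
  (n - m) * (n - m - 1) + m * (m + 1) <= (n - r) * (n - r - 1) + 2 * (r * r) ->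
  (n - m) * (n - m - 1) + m * (m + 1) <= (n - r) * (n - r - 1) + r * (n - 1) ->
  r <= m.
Proof.
move=> n1 n2 rn h1 h2; have key := order_bound n1 n2.
have [mr|//] := ltnP m r; exfalso.
have [u rE] : exists u, r = m + u by exists (r - m); lia.
have [v nE] : exists v, n = m + u + v + 1 by exists (n - r - 1); lia.
have E1 : n - m = u + v + 1 by lia.
have E2 : n - r = v + 1 by lia.
rewrite E1 E2 !addnK in h1 h2 key.
have H1 : 2 * (n * r) + 2 * (m * m) + 2 * m <= 3 * (r * r) + r + 2 * (m * n).
  by rewrite nE rE in h1 *; lia.
have H2 : n * r + 2 * (m * m) + 2 * m <= r * r + 2 * (m * n).
  by rewrite nE rE in h2 *; lia.
have {}key : 8 * (m * n) + 1 < n * n + 8 * (m * m) + 8 * m.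
  by rewrite nE in key *; lia.
have {}n2 : m * m + 5 * m + 6 <= 2 * n by lia.
clear h1 h2 E1 E2 v nE u rE.
have [n2r|n2r] := eqVneq n (2 * r); first by subst n; lia.
(* [H1] amounts to [(r - m) * (2 * n - 3 * (r + m) - 1) <= m * (m - 1)]. In the first case the
   second factor is at least 3, and [n2] bounds the right side below the left. *)
have [le|gt] := leqP (3 * (r + m + 1) + 1) (2 * n).
  have [u uE] : exists u, r = m + 1 + u by exists (r - m - 1); lia.
  have [v vE] : exists v, 2 * n = 3 * (r + m + 1) + 1 + v.
    by exists (2 * n - (3 * (r + m + 1) + 1)); lia.
  have := leq0n (u * v); rewrite -(leq_pmul2l (isT : 0 < 4)).
  have : 2 * (n * r) = r * (3 * (r + m + 1) + 1 + v) by rewrite -vE; lia.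
  have : 2 * (n * m) = m * (3 * (r + m + 1) + 1 + v) by rewrite -vE; lia.
  by rewrite uE in H1 vE *; lia.
(* Since [(n - 1 - 2 * r) * (6 * r - n - 1)] is nonnegative, [3 * r ^ 2 + r] is at most
   [2 * n * r - (n ^ 2 - 1) / 4], so [H1] contradicts [key]. *)
have [u uE] : exists u, n = 2 * r + 1 + u by exists (n - 2 * r - 1); lia.
have [v vE] : exists v, 6 * r = n + 1 + v by exists (6 * r - n - 1); lia.
have uv : u * (4 * r) = u * (2 + u + v) by congr (_ * _); lia.
by have := leq0n (u * v); subst n; lia.
Qed.

(** * The clique in the closure, and pancyclicity from the edge bound *)

Section DenseGraphs.
Variable T : finType.
Implicit Types (e : rel T) (A B : {set T}) (c p q : seq T).

Lemma clique_has_cycle e A : symmetric e -> {in A &, forall x y, x != y -> e x y} ->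
  1 < #|A| -> has_cycle_geq e #|A|.
Proof.
move=> es Acl /card_gt1P[x [y [xA yA xy]]].
have := @clique_cycle T e A x [:: y] es Acl xA yA; rewrite /= Acl //= inE xy yA /=.
by rewrite !addn0; apply.
Qed.

Lemma closed_clique e m : symmetric e -> irreflexive e -> nclosed e ->
  6 * m + 5 <= #|T| -> (m + 2) * (m + 3) <= 2 * #|T| ->
  (#|T| - m) * (#|T| - m - 1) + m * (m + 1) <= \sum_x deg e x ->
  exists K : {set T}, {in K &, forall x y, x != y -> e x y} /\ #|~: K| <= m.
Proof.
move=> es ei ecl; set n := #|T| => n1 n2 D.
pose K := [set x | n <= 2 * deg e x]; exists K.
have Kcl : {in K &, forall x y, x != y -> e x y}.
  by move=> x y; rewrite !inE => dx dy xy; apply: ecl => //; rewrite -/n; lia.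
split=> //; set r := #|~: K|.
have KE : #|K| = n - r by rewrite /r /n -(cardsC K) addnK.
have rn : r <= n by exact: max_card.
have degn x : deg e x <= n - 1 by rewrite /n -cardsT; apply: degin_le.
have r2 : 2 * r <= n.
  apply: (low_count_half n1 n2 rn D).
  rewrite (bigID (mem K)) /= mulnDr; apply: leq_add.
    by rewrite leq_mul2l /= -KE -sum_nat_const leq_sum.
  rewrite big_distrr /= -sum_nat_const.
  rewrite [X in _ <= X](eq_bigl (fun x => x \notin K)) => [|x]; last by rewrite !inE.
  by apply: leq_sum => x; rewrite inE -ltnNge; lia.
have degr x : x \in ~: K -> 2 * deg e x <= n - 1 /\ deg e x <= r.
  rewrite !inE -ltnNge => dx; split; first by lia.
  (* Vertices of [K] have degree at least [n - r - 1], so closedness would join [x] to all of [K].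
     Its degree would then be at least [n - r], hence at least [n / 2]. *)
  rewrite leqNgt; apply/negP => rx.
  have : #|K| <= deg e x.
    apply/subset_leq_card/subsetP => y yK; rewrite !inE /=; apply: ecl.
      by apply: contraTneq yK => <-; rewrite inE -ltnNge.
    have : #|K| - 1 <= deg e y.
      have -> : #|K| - 1 = #|K :\ y| by rewrite (cardsD1 y K) yK; lia.
      apply/subset_leq_card/subsetP => z; rewrite !inE /= -/n => /andP[zy zK].
      by apply: Kcl => //; rewrite ?inE // eq_sym.
    by rewrite KE -/n; lia.
  by rewrite KE; lia.
move: D; rewrite (sum_deg_clique es ei Kcl) KE => D.
have S x : 2 * degin e K x + degin e (~: K) x <= 2 * deg e x.
  by rewrite (deginC e K); lia.
apply: (low_count_bound n1 n2 r2); apply: leq_trans D _; rewrite leq_add2l.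
  rewrite mulnCA -sum_nat_const leq_sum // => x /degr[_ dr].
  by apply: leq_trans (S x) _; rewrite leq_mul2l.
by rewrite -sum_nat_const leq_sum // => x /degr[dr _]; apply: leq_trans (S x) _.
Qed.

(** With [t <= m] vertices off [c], the part of the degree sum involving them is at most
    [t * size c + t * (#|T| - 1)]. The rest exceeds half of [size c ^ 2], as
    [pancyclic_of_degree_sum] requires. *)
Lemma dense_pancyclic e m c l : symmetric e -> irreflexive e ->
  6 * m + 5 <= #|T| ->
  (#|T| - m) * (#|T| - m - 1) + m * (m + 1) <= \sum_x deg e x ->
  ucycle e c -> #|T| - m <= size c -> 2 < l <= size c ->
  exists2 c', ucycle e c' & size c' = l.
Proof.
move=> es ei; set n := #|T| => n1 D uc sc; apply: pancyclic_of_degree_sum => //.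
set A := [set z in c].
have cA : #|A| = size c by rewrite cardsE; apply/card_uniqP; case/andP: uc.
have sn : #|A| <= n by exact: max_card.
have degn x : deg e x <= n - 1 by rewrite /n -cardsT; apply: degin_le.
have nA : n - #|A| = #|~: A| by rewrite /n -(cardsC A) addKn.
have : \sum_x deg e x <=
    \sum_(x in A) degin e A x + (n - #|A|) * #|A| + (n - #|A|) * (n - 1).
  rewrite (bigID (mem A)) /=; apply: leq_add.
    rewrite mulnC -sum_nat_const -big_split /=; apply: leq_sum => x _.
    by rewrite (deginC e A) leq_add2l nA degin_le_card.
  rewrite nA -sum_nat_const [X in _ <= X](eq_bigl (fun x => x \notin A)) ?leq_sum // => x.
  by rewrite !inE.
rewrite -cA in sc *; move: (\sum_(x in A) _) D => S D.
move: (\sum_x _) D => S' D.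
rewrite expnS expn1; move: #|A| sn sc => s sn sc H {cA uc degn nA}.
have [t tE] : exists t, n = s + t by exists (n - s); lia.
have [u mE] : exists u, m = t + u by exists (m - t); lia.
have [q qE] : exists q : nat, n = m + q + 1 by exists (n - m - 1); lia.
have sE : s = q + 1 + u by lia.
have E1 : n - m = q + 1 by lia.
have E2 : n - s = t by lia.
have E3 : n - 1 = m + q by lia.
rewrite E1 E2 E3 addnK in D H.
have : (5 * m + 4) * q <= q * q by rewrite leq_mul2r; apply/orP; right; lia.
by subst s m; lia.
Qed.

End DenseGraphs.

Lemma sum_eq_pointwise (I : finType) (A : {set I}) (F G : I -> nat) :
  {in A, forall i, F i <= G i} -> \sum_(i in A) G i <= \sum_(i in A) F i ->
  {in A, F =1 G}.
Proof.
move=> FG GF i iA; apply/eqP; rewrite eqn_leq FG //=.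
move: GF; rewrite (bigD1 i) //= [X in _ <= X](bigD1 i) //=.
have : \sum_(j in A | j != i) F j <= \sum_(j in A | j != i) G j.
  by apply: leq_sum => j /andP[/FG].
lia.
Qed.

(** * Paths outside the clique and the extremal structures *)

Section Structure.
Variable T : finType.
Implicit Types (e : rel T) (A B K S : {set T}) (c p q : seq T).

Lemma has_cycle_geq_mono e s t : t <= s -> has_cycle_geq e s -> has_cycle_geq e t.
Proof. by move=> ts [c uc sc]; exists c => //; apply: leq_trans sc. Qed.

Lemma through_cycle e K x p y : symmetric e ->
  {in K &, forall x y, x != y -> e x y} -> x \in K -> y \in K -> x != y ->
  path e x (rcons p y) -> uniq p -> all [predC K] p -> has_cycle_geq e (#|K| + size p).
Proof.
move=> es Kcl xK yK xy pe up pK.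
have notp z : z \in K -> z \notin p.
  by move=> zK; apply/negP => /(allP pK); rewrite /= zK.
have -> : size p = count [predC K] (rcons p y).
  by rewrite -cats1 count_cat /= yK /= !addn0; apply/esym/eqP; rewrite -all_count.
apply: (clique_cycle es Kcl xK) => //; rewrite ?last_rcons ?size_rcons //.
by rewrite cons_uniq mem_rcons inE negb_or xy notp // rcons_uniq notp.
Qed.

(** Isolating [S] instead of passing to an induced subgraph keeps the vertex type, so that [connect]
    applies to vertices of [T] directly. *)
Definition off e S := [rel a b | [&& e a b, a \notin S & b \notin S]].

Lemma off_sym e S : symmetric e -> symmetric (off e S).
Proof. by move=> es a b; rewrite /off /= es [in LHS]andbCA andbA andbC andbA andbC. Qed.

Lemma connect_off e S a b : a \notin S -> connect (off e S) a b ->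
  exists p, [/\ path e a p, last a p = b, uniq (a :: p) & all [predC S] (a :: p)].
Proof.
move=> aS /connectP[p /shortenP[q qe uq _] ->]; exists q; split=> //.
  by apply: sub_path qe => x y /and3P[].
rewrite /= aS /=; elim: q a aS qe uq => //= x q IH a aS /andP[/and3P[_ _ xS] qe] /andP[_ uq].
by rewrite xS (IH x).
Qed.

(* Every component of the complement of [S] has at most one neighbour in [S]. *)
Definition attached e S := forall a b x y, connect (off e S) a b ->
  a \notin S -> b \notin S -> x \in S -> y \in S -> e a x -> e b y -> x = y.

Section Extremal.
Variables (e : rel T) (K : {set T}) (m : nat).
Hypotheses (es : symmetric e) (ei : irreflexive e).
Hypothesis Kcl : {in K &, forall x y, x != y -> e x y}.

Lemma attached_clique : ~ has_cycle_geq e #|K|.+1 -> attached e K.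
Proof.
move=> nc a b x y ab aK bK xK yK ax by_; apply/eqP; apply/negP => /negP xy.
have [p [pe lp up pK]] := connect_off aK ab.
apply: nc; apply: (@has_cycle_geq_mono _ (#|K| + size (a :: p))).
  by rewrite /= addnS leq_addr.
apply: (@through_cycle _ _ x _ y) => //.
by rewrite rcons_path /= lp by_ pe es ax.
Qed.

Hypothesis nc : ~ has_cycle_geq e (#|K| + 2).

Lemma no_through x p y : x \in K -> y \in K -> x != y ->
  path e x (rcons p y) -> uniq p -> all [predC K] p -> size p < 2.
Proof.
move=> xK yK xy pe up pK; rewrite ltnNge; apply/negP => p2; apply: nc.
by apply: has_cycle_geq_mono (through_cycle es Kcl xK yK xy pe up pK); rewrite leq_add2l.
Qed.

Lemma count_closed_path x p : x \in K -> last x p \in K -> path e x p ->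
  uniq (x :: p) -> 0 < size p -> count [predC K] p < 2.
Proof.
move=> xK lK pe up p0; rewrite ltnNge; apply/negP => p2; apply: nc.
by apply: has_cycle_geq_mono (clique_cycle es Kcl xK lK pe up p0); rewrite leq_add2l.
Qed.

Let W := [set l in ~: K | 1 < degin e K l].

Lemma two_nbrs l : l \in W -> forall z, exists2 x, x \in K & (x != z) && e l x.
Proof.
rewrite inE => /andP[_ /card_gt1P[x [y []]]]; rewrite !inE => /andP[xK lx] /andP[yK ly] xy z.
have [xz|xz] := eqVneq x z; last by exists x; rewrite ?xz.
by exists y; rewrite // -xz eq_sym xy.
Qed.

(** If a component off [l |: K] has two neighbours in [K], the joining path has a single interior
    vertex, which lies in [W] without being [l]. If one of its two neighbours is [l], the path goes
    on through [l] to another vertex of [K] and has too many interior vertices. *)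
Lemma attached_one l : W = [set l] -> attached e (l |: K).
Proof.
move=> WE a b x y ab aS bS xS yS ax by_; apply/eqP; apply/negP => /negP xy.
have lW : l \in W by rewrite WE inE.
have lK : l \notin K by move: lW; rewrite !inE => /andP[].
have aux a' b' y' : connect (off e (l |: K)) a' b' -> a' \notin l |: K ->
    e a' l -> e b' y' -> y' \in K -> False.
  move=> ab' aS' al by' yK'; have [p [pe lp up pS]] := connect_off aS' ab'.
  have [x' xK /andP[xy' lx]] := two_nbrs lW y'.
  suff : size (l :: a' :: p) < 2 by [].
  apply: (@no_through x' _ y') => //.
  - by rewrite rcons_path /= lp by' pe (es x') lx (es l) al.
  - by rewrite cons_uniq up andbT; apply/negP => /(allP pS); rewrite !inE eqxx.
  - apply/allP => z; rewrite inE => /orP[/eqP->|/(allP pS)]; rewrite !inE // negb_or.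
    by case/andP.
have [xl|xl] := eqVneq x l.
  have yK : y \in K by move: yS; rewrite !inE -xl eq_sym (negbTE xy).
  by apply: (aux a b y) => //; rewrite -xl.
have xK : x \in K by move: xS; rewrite !inE (negbTE xl).
have [yl|yl] := eqVneq y l.
  apply: (aux b a x) => //; last by rewrite -yl.
  by rewrite (sym_connect_sym (off_sym _ es)).
have yK : y \in K by move: yS; rewrite !inE (negbTE yl).
have [p [pe lp up pS]] := connect_off aS ab.
have : size (a :: p) < 2.
  apply: (@no_through x _ y) => //.
    by rewrite rcons_path /= lp by_ pe es ax.
  by apply/allP => z /(allP pS); rewrite !inE negb_or => /andP[].
case: p lp {pe up pS} => // /= ab0 _; rewrite -ab0 in by_.
have : a \in W.
  rewrite !inE; move: aS; rewrite !inE negb_or => /andP[_ ->] /=.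
  by apply/card_gt1P; exists x, y; rewrite !inE xK yK.
by rewrite WE inE => /eqP aE; move: aS; rewrite aE !inE eqxx.
Qed.

Hypothesis cL : #|~: K| = m.
Hypothesis D : m * (m + 1) <= \sum_(x in ~: K) (2 * degin e K x + degin e (~: K) x).

(** Each summand in [D] is at most [2 + (m - 1)], so [D] forces equality throughout. Two adjacent
    vertices outside [K] with different neighbours in [K] would form the interior of a path excluded
    by [no_through]. *)
Lemma extremal_L : W = set0 -> 1 < m -> exists2 v, v \in K &
  {in ~: K &, forall x y, x != y -> e x y} /\
  {in ~: K & K, forall a x, e a x = (x == v)}.
Proof.
move=> W0 m1.
have dK a : a \in ~: K -> degin e K a <= 1.
  by move=> aL; have := in_set0 a; rewrite -W0 !inE -in_setC aL /= ltnNge => /negbFE.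
have dL a : a \in ~: K -> degin e (~: K) a <= m - 1.
  by move=> aL; rewrite -cL; apply: degin_le.
have dE a : a \in ~: K -> degin e K a = 1 /\ degin e (~: K) a = m - 1.
  move=> aL; have := @sum_eq_pointwise _ (~: K)
    (fun x => 2 * degin e K x + degin e (~: K) x) (fun=> m + 1) _ _ a aL.
  rewrite sum_nat_const cL; move=> /(_ _ D) /= H.
  have {}H : 2 * degin e K a + degin e (~: K) a = m + 1.
    by apply: H => i iL; have := dK i iL; have := dL i iL; lia.
  by have := dK a aL; have := dL a aL; lia.
have Lcl : {in ~: K &, forall x y, x != y -> e x y}.
  move=> x y xL yL xy; apply/negP => /negP nxy.
  by have := degin_nonadj ei xL yL nxy xy; rewrite cL; case: (dE x xL) => _ ->; lia.
have nbr a : a \in ~: K -> exists2 v, v \in K & forall x, x \in K -> e a x = (x == v).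
  move=> aL; case: (dE a aL) => /eqP/cards1P[v vE] _.
  exists v => [|x xK]; first by have := set11 v; rewrite -vE inE => /andP[].
  by move/setP/(_ x): vE; rewrite !inE xK.
have [l lL] : exists l, l \in ~: K by apply/set0Pn; rewrite -cards_eq0 cL; lia.
have [v vK lv] := nbr l lL; exists v => //; split=> // a x aL xK.
have [->|al] := eqVneq a l; first exact: lv.
have [w wK aw] := nbr a aL; rewrite aw //; congr (_ == _).
apply/eqP; apply/negP => /negP wv; suff : size [:: a; l] < 2 by [].
apply: (@no_through w _ v) => //=.
- by rewrite (es w) aw // eqxx Lcl // lv // eqxx.
- by rewrite inE al.
- by move: aL lL; rewrite !inE => -> ->.
Qed.

(** Excluded paths show that [W] is independent and that its vertices have the same two neighbours
    in [K]. They also bound the summands in [D], which leaves [m <= 3] and no vertex outside both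
    [K] and [W]. *)
Lemma extremal_Gamma : 1 < #|W| -> m <= 3 /\ exists x y, [/\ x \in K, y \in K, x != y,
  {in ~: K &, forall a b, e a b = false} &
  {in ~: K & K, forall a z, e a z = (z \in [set x; y])}].
Proof.
have low_deg (u v w s : nat) : u <= 1 -> v <= 1 -> w <= s - 1 -> 0 < s ->
  u = 0 \/ v = 0 -> 2 * u + (v + w) <= s + 1 by lia.
have small_m (t s : nat) : 0 < t ->
    (t + s) * (t + s + 1) <= t * (4 + s) + s * (s + 1) -> t + s <= 3.
  move=> t0 H; rewrite -(leq_pmul2l t0); lia.
have small_s (t s : nat) : t + s <= 3 -> 1 < t -> 0 < s -> t = 2 /\ s = 1 by lia.
have pos_deg (u v : nat) : u <= 2 -> 2 * u + v = 5 -> 0 < v by lia.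
case/card_gt1P=> l1 [l2 [l1W l2W l12]].
have WK l : l \in W -> l \notin K by rewrite !inE => /andP[].
(* If [x'] were neither [x] nor [y], take another neighbour [y'] of [l'] in [K]: a path joining [x]
   and [y] through [l] continues via [y'] and [l'] to [x'], with two vertices outside [K]. The cases
   differ by whether [y'] is [x] or [y]. *)
have two l l' x y x' : l \in W -> l' \in W -> l != l' -> x \in K -> y \in K -> x != y ->
    e l x -> e l y -> x' \in K -> e l' x' -> x' \in [set x; y].
  move=> lW l'W ll' xK yK xy lx ly x'K l'x'; rewrite !inE; apply/negP => /negP.
  rewrite negb_or => /andP[x'x x'y].
  have [y' y'K /andP[y'x' l'y']] := two_nbrs l'W x'.
  have [lK l'K] := (WK _ lW, WK _ l'W).
  have sym2 (a b : T) : a != b -> ((a == b) = false) * ((b == a) = false).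
    by move=> ab; split; apply/negbTE; rewrite // eq_sym.
  have ne z k : z \in K -> k \notin K -> ((z == k) = false) * ((k == z) = false).
    by move=> zK kK; apply: sym2; apply: contraNneq kK => <-.
  have neK := (ne _ _ xK lK, ne _ _ xK l'K, ne _ _ yK lK, ne _ _ yK l'K,
    ne _ _ x'K lK, ne _ _ x'K l'K, ne _ _ y'K lK, ne _ _ y'K l'K,
    sym2 _ _ xy, sym2 _ _ x'x, sym2 _ _ x'y, sym2 _ _ ll').
  have [y'y|y'y] := eqVneq y' y.
    subst y'; suff : count [predC K] [:: l; y; l'; x'] < 2.
      by rewrite /= yK x'K (negbTE lK) (negbTE l'K).
    apply: (@count_closed_path x) => //; first by rewrite /= (es x) lx ly (es y) l'y' l'x'.
    by rewrite /= !inE !neK.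
  have [y'x|y'x] := eqVneq y' x.
    subst y'; suff : count [predC K] [:: l; x; l'; x'] < 2.
      by rewrite /= xK x'K (negbTE lK) (negbTE l'K).
    apply: (@count_closed_path y) => //; first by rewrite /= (es y) ly lx (es x) l'y' l'x'.
    by rewrite /= !inE !neK.
  suff : count [predC K] [:: l; y; y'; l'; x'] < 2.
    by rewrite /= yK y'K x'K (negbTE lK) (negbTE l'K).
  apply: (@count_closed_path x) => //.
    by rewrite /= (es x) lx ly Kcl 1?eq_sym // (es y') l'y' l'x'.
  by rewrite /= !inE !neK !(sym2 _ _ y'x, sym2 _ _ y'y, sym2 _ _ y'x').
have [x xK /andP[_ l1x]] := two_nbrs l1W l1.
have [y yK /andP[]] := two_nbrs l1W x; rewrite eq_sym => xy l1y.
have sub l z : l \in W -> z \in K -> e l z -> z \in [set x; y].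
  have [->|ll1] := eqVneq l l1 => lW zK lz; last first.
    by apply: (two l1 l) => //; rewrite eq_sym.
  have sub2 z' : z' \in K -> e l2 z' -> z' \in [set x; y] by apply: (two l1 l2).
  have [x2 x2K /andP[_ e2]] := two_nbrs l2W l2.
  have [y2 y2K /andP[xy2 f2]] := two_nbrs l2W x2.
  have [l2x l2y] : e l2 x /\ e l2 y.
    move: (sub2 _ x2K e2) (sub2 _ y2K f2); rewrite !inE.
    by case/orP=> /eqP xE; case/orP=> /eqP yE; subst x2 y2; rewrite ?eqxx // in xy2.
  by apply: (two l2 l1) => //; rewrite eq_sym.
have nbr l z : l \in W -> z \in K -> e l z = (z \in [set x; y]).
  move=> lW zK; apply/idP/idP => [|zxy]; first exact: sub.
  have [x2 x2K /andP[_ e2]] := two_nbrs lW l.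
  have [y2 y2K /andP[xy2 f2]] := two_nbrs lW x2.
  move: (sub _ _ lW x2K e2) (sub _ _ lW y2K f2) zxy; rewrite !inE.
  by case/orP=> /eqP xE; case/orP=> /eqP yE; subst x2 y2; rewrite ?eqxx // in xy2;
    case/orP=> /eqP->.
have [nbrx nbry] : {in W, forall l, e l x} /\ {in W, forall l, e l y}.
  by split=> l lW; rewrite nbr // !inE eqxx ?orbT.
have Wind : {in W &, forall l l', e l l' = false}.
  move=> l l' lW l'W; apply/negP => ll'; suff : size [:: l; l'] < 2 by [].
  apply: (@no_through x _ y) => //=.
  - by rewrite (es x) nbrx // ll' nbry.
  - by rewrite inE andbT; apply: contraTneq ll' => ->; rewrite ei.
  - by rewrite !WK.
have WL : W \subset ~: K by apply/subsetP => l; rewrite !inE => /andP[].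
have oneW w : w \notin K -> w \notin W -> degin e W w <= 1.
  move=> wK wW; rewrite leqNgt; apply/negP => /card_gt1P[l [l' []]].
  rewrite !inE -!in_setC => /andP[lW wl] /andP[l'W wl'] ll'.
  suff : size [:: l; w; l'] < 2 by [].
  have {}lW : l \in W by rewrite !inE -in_setC.
  have {}l'W : l' \in W by rewrite !inE -in_setC.
  apply: (@no_through x _ y) => //=.
  - by rewrite (es x) nbrx // (es l) wl wl' nbry.
  - rewrite !inE negb_or ll' !andbT; apply/andP; split.
      by apply: contraNneq wW => <-.
    by apply: contraNneq wW => ->.
  - by rewrite (WK l) // wK (WK l') //.
have zeroW w z : w \notin K -> w \notin W -> z \in K -> e w z -> degin e W w = 0.
  move=> wK wW zK wz; apply/eqP; rewrite -leqn0 leqNgt; apply/negP.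
  rewrite card_gt0 => /set0Pn[l]; rewrite inE => /andP[lW wl].
  have [x0 x0K /andP[x0z lx0]] := two_nbrs lW z.
  suff : size [:: l; w] < 2 by [].
  apply: (@no_through x0 _ z) => //=.
  - by rewrite (es x0) lx0 (es l) wl wz.
  - by rewrite inE andbT; apply: contraNneq wW => <-.
  - by rewrite (WK l) // wK.
pose t := #|W|; pose s := #|~: K :\: W|.
have ts : m = t + s.
  by rewrite /t /s -cL cardsD (setIidPr WL) subnKC // subset_leq_card.
have t2 : 1 < t by apply/card_gt1P; exists l1, l2.
have dLE a : degin e (~: K) a = degin e W a + degin e (~: K :\: W) a.
  rewrite -deginU; last by rewrite -setI_eq0 setIDA setDIl setDv set0I.
  by rewrite -[X in X :|: _](setIidPr WL) setID.
(* A vertex of [W] has two neighbours in [K] and none in [W]; any other vertex outside [K] has at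
   most one in [K] and at most one in [W], but not both. *)
pose g a := if a \in W then 4 + s else s + 1.
have Wdeg l : l \in W -> degin e W l = 0.
  move=> lW; apply/eqP; rewrite cards_eq0; apply/eqP/setP => l'; rewrite !inE -!in_setC.
  by apply/negP => /andP[l'W]; rewrite Wind // !inE -in_setC.
have le_g a : a \in ~: K -> 2 * degin e K a + degin e (~: K) a <= g a.
  rewrite inE => aK; rewrite /g dLE; case: ifPn => aW.
    have -> : degin e K a = 2.
      rewrite /degin -[2]/(true.+1) -xy -cards2; apply: eq_card => z; rewrite inE.
      case: (boolP (z \in K)) => zK /=; first by rewrite nbr.
      by apply/esym/negP; rewrite !inE => /orP[]/eqP zE; rewrite zE ?xK ?yK in zK.
    by rewrite Wdeg // leq_add2l add0n degin_le_card.
  have H1 : degin e (~: K :\: W) a <= s - 1 by apply: degin_le; rewrite // inE aW inE.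
  have s0 : 0 < s by rewrite card_gt0; apply/set0Pn; exists a; rewrite inE aW inE.
  have H2 : degin e K a <= 1 by move: aW; rewrite !inE aK /= -leqNgt.
  have H3 := oneW a aK aW.
  apply: low_deg => //; case: (posnP (degin e K a)) => [->|]; first by left.
  rewrite card_gt0 => /set0Pn[z]; rewrite inE => /andP[zK az].
  by right; apply: (zeroW a z).
have sumg : \sum_(a in ~: K) g a = t * (4 + s) + s * (s + 1).
  rewrite (big_setID W) /= (setIidPr WL); congr (_ + _).
    by rewrite -sum_nat_const; apply: eq_bigr => a aW; rewrite /g aW.
  rewrite -sum_nat_const; apply: eq_bigr => a; rewrite inE /g => /andP[/negbTE-> //].
have m3 : m <= 3.
  rewrite ts; apply: small_m; first exact: ltnW.
  by rewrite -sumg -ts; apply: leq_trans D _; apply: leq_sum.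
split=> //; exists x, y.
suff s0 : s = 0.
  have KW : {subset ~: K <= W}.
    move/eqP: s0; rewrite cards_eq0 setD_eq0 => /subsetP H a; exact: H.
  split=> // [a b aL bL|a z aL zK]; first by apply: Wind; apply: KW.
  by apply: nbr => //; apply: KW.
(* The only alternative is [t = 2] and [s = 1], with equality in [D]. Then both vertices of [W] are
   adjacent to the remaining vertex [w], against [oneW]. *)
case: (posnP s) => // s0; exfalso.
have [tE sE] : t = 2 /\ s = 1 by apply: small_s; rewrite // -ts.
have gE : {in ~: K, forall a, 2 * degin e K a + degin e (~: K) a = g a}.
  apply: sum_eq_pointwise => //; apply: leq_trans D.
  by rewrite sumg ts tE sE.
have [w wE] : exists w, ~: K :\: W = [set w] by apply/cards1P; rewrite -/s sE.
have wadj l : l \in W -> e w l.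
  move=> lW; have := gE l (subsetP WL _ lW); rewrite /g lW.
  have dK : degin e K l <= 2.
    rewrite -[2]/(true.+1) -xy -cards2; apply/subset_leq_card/subsetP => z.
    by rewrite inE => /andP[zK]; rewrite nbr.
  rewrite dLE Wdeg // add0n sE => /(pos_deg _ _ dK).
  by rewrite wE card_gt0 => /set0Pn[z]; rewrite !inE => /andP[/eqP->]; rewrite es.
have : w \in ~: K :\: W by rewrite wE inE.
rewrite inE in_setC => /andP[wW wK]; have := oneW w wK wW.
rewrite leqNgt => /negP[]; apply/card_gt1P; exists l1, l2.
by split=> //; rewrite inE ?l1W ?l2W wadj.
Qed.

End Extremal.
End Structure.

(** * Edge counts as degree sums *)

Lemma sum_deg_num_edges (G : sgraph) : \sum_x deg (@adj G) x = 2 * num_edges G.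
Proof.
pose P := [set p : G * G | adj p.1 p.2]; pose f (p : G * G) := [set p.1; p.2].
have -> : \sum_x deg (@adj G) x = #|P|.
  under eq_bigr do rewrite /deg degin_sumE.
  rewrite pair_big /= -sum1_card [RHS]big_mkcond.
  by apply: eq_big => [[x y]|[x y] _]; rewrite ?inE //; case: adj.
have fE p : p \in P -> f p \in edges G.
  by rewrite inE => pP; apply/imset2P; exists p.1 p.2; rewrite ?inE.
rewrite -sum1_card (partition_big f (mem (edges G))) //= mulnC -sum_nat_const.
apply: eq_bigr => E /imset2P[x y _]; rewrite !inE /= => xy ->.
have xNy : x != y by apply: contraTneq xy => ->; rewrite adj_irr.
rewrite (eq_bigl (mem [set (x, y); (y, x)])) ?sum1_card ?cards2 ?xpair_eqE ?(negbTE xNy) //.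
move=> [a b]; rewrite /f !inE /= !xpair_eqE; apply/andP/idP; last first.
  case/orP=> /andP[/eqP-> /eqP->]; first by rewrite xy.
  by rewrite adj_sym xy setUC.
case=> ab /eqP/setP E2; have := E2 a; have := E2 b; rewrite !inE !eqxx orbT /=.
have aNb : a != b by apply: contraTneq ab => ->; rewrite adj_irr.
case/esym/orP=> /eqP bE; case/esym/orP=> /eqP aE; subst a b; rewrite ?eqxx ?orbT //;
  by rewrite eqxx in aNb.
Qed.

(** Degrees can only grow from [adj] to [e'], so the bound on the sums forces equal degrees, hence
    equal neighbourhoods. This lets isomorphisms found for the closure descend to [G]. *)
Lemma adj_eq_of_sum_deg (G : sgraph) (e' : rel G) : subrel (@adj G) e' ->
  \sum_x deg e' x <= \sum_x deg (@adj G) x -> forall x y, adj x y = e' x y.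
Proof.
move=> sub le x y.
have dE : deg (@adj G) x = deg e' x.
  apply: (@sum_eq_pointwise _ setT) => //.
  - by move=> i _; apply: degin_mono.
  - by under eq_bigl do rewrite inE; under [X in _ <= X]eq_bigl do rewrite inE.
apply/idP/idP => [/sub //|e'xy].
have /eqP/setP/(_ y) : [set y in setT | adj x y] == [set y in setT | e' x y].
  rewrite eqEcard; apply/andP; split.
    by apply/subsetP => z; rewrite !inE; apply: sub.
  by move: dE; rewrite /deg /degin => ->.
by rewrite !inE e'xy.
Qed.

(** * Embedding in a member of the family F *)

Section Host.
Variables (T : finType) (e : rel T) (S : {set T}) (s0 : T).
Hypotheses (es : symmetric e) (ei : irreflexive e) (s0S : s0 \in S).

(* The vertex of [S] to which the component of [a] off [S] is attached; [s0] if
   that component has no neighbour in [S]. *)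
Definition port a :=
  odflt s0 [pick x | (x \in S) && [exists b, connect (off e S) a b && e b x]].

Lemma port_in a : port a \in S.
Proof. by rewrite /port; case: pickP => [x /andP[]|]. Qed.

Lemma port_connect a b : connect (off e S) a b -> port a = port b.
Proof.
move=> ab; rewrite /port; congr odflt; apply: eq_pick => x /=; congr andb.
by apply: eq_existsb => c; rewrite (same_connect (sym_connect_sym (off_sym S es)) ab).
Qed.

Definition host_adj : rel T := fun a b => (a != b) &&
  match a \in S, b \in S with
  | true, true => true
  | true, false => a == port b
  | false, true => b == port a
  | false, false => connect (off e S) a b
  end.

Lemma host_sym : symmetric host_adj.
Proof.
move=> a b; rewrite /host_adj eq_sym; congr andb.
by case: (a \in S); case: (b \in S) => //; apply: sym_connect_sym; apply: off_sym.
Qed.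

Lemma host_irr : irreflexive host_adj.
Proof. by move=> a; rewrite /host_adj eqxx. Qed.

Definition host := SGraph host_sym host_irr.

(** Outside [S], adjacency in [host] is connectivity under [off e S]; so the components of [e] off
    [S] become cliques without merging, and [port] is constant on each. *)
Lemma host_in_F j : #|S| = #|T| - j -> in_F #|T| j host.
Proof.
move=> cS; split=> //; exists S; split=> //.
  by move=> x y xS yS xy; rewrite /= /host_adj xy xS yS.
move=> C /imsetP[C' /imsetP[x0 _ ->] ->].
have conn (u v : induced (~: (S : {set host}))) :
    connect (@adj (induced (~: (S : {set host})))) u v -> connect (off e S) (val u) (val v).
  case/connectP=> p pe ->; elim: p u pe => [|w p IH] u //= /andP[uw /IH].
  apply: connect_trans; move: uw; rewrite /induced_adj /= /host_adj.
  have := valP u; have := valP w; rewrite !inE => /negbTE-> /negbTE->.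
  by case/andP.
have notS (u : induced (~: (S : {set host}))) : val u \in S = false.
  by have := valP u; rewrite inE => /negbTE.
split.
  move=> x y /imsetP[u]; rewrite inE => /conn xu -> /imsetP[v]; rewrite inE => /conn xv -> uv.
  rewrite /= /host_adj uv !notS /=; apply: connect_trans xv.
  by rewrite (sym_connect_sym (off_sym _ es)).
exists (port (val x0)); first exact: port_in.
move=> x /imsetP[u]; rewrite inE => /conn xu -> w wS.
rewrite /= /host_adj notS wS (port_connect xu) andbC.
by case: eqP => //= ->; apply: contraTneq (port_in (val u)) => <-; rewrite notS.
Qed.

Lemma host_adj_sub : attached e S -> subrel e host_adj.
Proof.
have portE a x : attached e S -> a \notin S -> x \in S -> e a x -> x = port a.
  move=> att aS xS ax; rewrite /port; case: pickP => [y /andP[yS /existsP[b /andP[ab by_]]]|].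
    apply: (att a b) => //; have [p [_ lp _ pS]] := connect_off aS ab.
    by apply: (allP pS); rewrite -lp mem_last.
  by move/(_ x); rewrite xS; case: existsP => // -[]; exists a; rewrite connect0.
move=> att a b ab; rewrite /host_adj; apply/andP; split.
  by apply: contraTneq ab => ->; rewrite ei.
case: (boolP (a \in S)) => aS; case: (boolP (b \in S)) => bS //.
- by apply/eqP; apply: portE => //; rewrite es.
- exact/eqP/portE.
- by apply: connect1; rewrite /off /= ab aS.
Qed.

End Host.

(** * Recognising [L] and [Gamma] from a vertex partition *)

Lemma bijection_of_partition (T : finType) (A B C : {set T}) a b c :
  #|A| = a -> #|B| = b -> #|C| = c -> 0 < a -> 0 < b -> 0 < c ->
  [disjoint A & B] -> C = ~: (A :|: B) ->
  exists2 f : T -> 'I_a + ('I_b + 'I_c), bijective f &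
    forall x, match f x with
      | inl _ => x \in A | inr (inl _) => x \in B | inr (inr _) => x \in C end.
Proof.
move=> <- <- <- /card_gt0P[a0 A0] /card_gt0P[b0 B0] /card_gt0P[c0 C0] AB CE.
pose f x : 'I_#|A| + ('I_#|B| + 'I_#|C|) :=
  if x \in A then inl (enum_rank_in A0 x) else
  if x \in B then inr (inl (enum_rank_in B0 x)) else inr (inr (enum_rank_in C0 x)).
pose g (i : 'I_#|A| + ('I_#|B| + 'I_#|C|)) : T :=
  match i with inl i => enum_val i | inr (inl i) => enum_val i | inr (inr i) => enum_val i end.
have inC x : x \notin A -> x \notin B -> x \in C by move=> xA xB; rewrite CE !inE negb_or xA.
have notC x : x \in C -> ((x \in A) = false) * ((x \in B) = false).
  by rewrite CE !inE negb_or => /andP[/negbTE-> /negbTE->].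
exists f; last first.
  move=> x; rewrite /f; case: (boolP (x \in A)) => // xA; case: (boolP (x \in B)) => // xB.
  exact: inC.
exists g => [x|i].
  rewrite /f; case: (boolP (x \in A)) => [xA|xA] /=; first by rewrite enum_rankK_in.
  case: (boolP (x \in B)) => [xB|xB] /=; first by rewrite enum_rankK_in.
  by rewrite enum_rankK_in // inC.
rewrite /f; case: i => [i|[i|i]] /=; have iP := enum_valP i.
- by rewrite iP enum_valK_in.
- by rewrite (disjointFl AB iP) iP enum_valK_in.
- by rewrite !notC // enum_valK_in.
Qed.

Lemma double_bin2 n : 2 * 'C(n, 2) = n * (n - 1).
Proof. by rewrite mulnC bin_ffact ffactnS ffactn1 subn1. Qed.

(** One statement serves both target graphs: [h = true] is for [L], [h = false] for [Gamma]. *)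
Lemma isomorphic_join (G : sgraph) (A B C : {set G}) (h : bool) a b c :
  #|A| = a -> #|B| = b -> #|C| = c -> 0 < a -> 0 < b -> 0 < c ->
  [disjoint A & B] -> C = ~: (A :|: B) ->
  {in A :|: B &, forall x y, x != y -> adj x y} ->
  {in C & A, forall x y, adj x y} -> {in C & B, forall x y, adj x y = false} ->
  {in C &, forall x y, adj x y = h && (x != y)} ->
  isomorphic G (join (complete a)
    (disjoint_union (complete b) (if h then complete c else edgeless c))).
Proof.
move=> cA cB cC a0 b0 c0 AB CE cl eCA eCB eC.
have [f fb fP] := bijection_of_partition cA cB cC a0 b0 c0 AB CE.
have {}cl : {in A :|: B &, forall x y, adj x y = (x != y)}.
  move=> x y xP yP; have [->|xy] := eqVneq x y; first exact: adj_irr.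
  exact: cl.
case: h eC => eC; exists f => // x y; move: (fP x) (fP y) (inj_eq (bij_inj fb) x y);
  case: (f x) => [i|[i|i]]; case: (f y) => [j|[j|j]] xP yP fE;
  rewrite /= /complete_adj /edgeless_adj.
all: try by rewrite cl ?inE ?xP ?yP ?orbT // -fE.
all: try by rewrite eC // -fE.
all: first [by rewrite eCA | by rewrite eCB | by rewrite adj_sym eCA | by rewrite adj_sym eCB].
Qed.

Theorem theorem1p5 (k n : nat) (G : sgraph)
  (hG : gorder G = n)
  (hn : maxn (6 * k + 17) ((k + 4) * (k + 5) %/ 2) <= n)
  (he : 'C(n - k - 2, 2) + 'C(k + 3, 2) <= num_edges G) :
  (weakly_pancyclic G /\ is_girth G 3) /\
  (~ has_cycle G (n - k) ->
     (exists F : sgraph, in_F n (k + 1) F /\ subgraph G F)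
     \/ isomorphic G (L n (k + 2))
     \/ (k = 0 /\ subgraph G (Gamma n 2))
     \/ (k = 1 /\ isomorphic G (Gamma n 3))).
Proof.
have es := @adj_sym G; have ei := @adj_irr G.
pose m := k + 2; rewrite /gorder in hG.
have n1 : 6 * m + 5 <= #|G| by rewrite hG /m; move: hn; rewrite geq_max => /andP[]; lia.
have n2 : (m + 2) * (m + 3) <= 2 * #|G|.
  move: hn; rewrite geq_max hG => /andP[_].
  have := double_bin2 (k + 5); rewrite (_ : k + 5 - 1 = k + 4); last by lia.
  by rewrite (mulnC (k + 4)) => <-; rewrite mulKn // /m => H; have := double_bin2 (k + 5); lia.
have D : (#|G| - m) * (#|G| - m - 1) + m * (m + 1) <= \sum_x deg (@adj G) x.
  rewrite sum_deg_num_edges -double_bin2 hG /m subnDA.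
  have := double_bin2 (k + 3); rewrite (_ : k + 3 - 1 = k + 2); last by lia.
  by rewrite (_ : k + 2 + 1 = k + 3); lia.
have [e' [e's e'i sub e'c e'cyc]] := closure_exists es ei.
have D' : (#|G| - m) * (#|G| - m - 1) + m * (m + 1) <= \sum_x deg e' x.
  by apply: leq_trans D _; apply: leq_sum => x _; apply: degin_mono.
have [K [Kcl Km]] := closed_clique e's e'i e'c n1 n2 D'.
have nK := cardsC K.
have [c uc sc] : has_cycle_geq (@adj G) (#|G| - m).
  apply: e'cyc; first by lia.
  by apply: has_cycle_geq_mono (clique_has_cycle e's Kcl _); lia.
have pan c' l : ucycle (@adj G) c' -> #|G| - m <= size c' -> 2 < l <= size c' -> has_cycle G l.
  move=> uc' sc' lc; split; first by case/andP: lc.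
  by have [c'' uc'' sz] := dense_pancyclic es ei n1 D uc' sc' lc; exists c''.
split.
  split.
    move=> g s [[g3 _] _] [[s3 [c' sz uc']] cmax] l /andP[gl ls].
    apply: (pan c') => //; last by rewrite sz ls andbT (leq_trans g3).
    rewrite sz; apply: (leq_trans sc); apply: cmax; split; last by exists c.
    by apply: (leq_trans _ sc); lia.
  split; last by move=> l [].
  by apply: (pan c) => //=; apply: (leq_trans _ sc); lia.
move=> nocyc.
(* Such a cycle of the closure would give one at least as long in [G], and by [pan] also one of
   length exactly [n - k]. *)
have noc : ~ has_cycle_geq e' (n - k).
  move=> /e'cyc[|c' uc' sc']; first by rewrite -hG; lia.
  apply: nocyc; apply: (pan c') => //; first by apply: (leq_trans _ sc'); lia.
  by rewrite sc' andbT; lia.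
have famF (S : {set G}) : #|S| = n - (k + 1) -> attached e' S ->
    exists F : sgraph, in_F n (k + 1) F /\ subgraph G F.
  move=> cS att; have /card_gt0P[s0 s0S] : 0 < #|S| by rewrite cS -hG; lia.
  exists (host S s0 e's); split; first by rewrite -hG; apply: host_in_F; rewrite // hG.
  by exists id => // x y /sub; apply: host_adj_sub.
have [rk|rk] := leqP #|~: K| (k + 1).
  left; apply: (famF K).
    have [//|H] := eqVneq #|K| (n - (k + 1)).
    by case: noc; apply: has_cycle_geq_mono (clique_has_cycle e's Kcl _); lia.
  apply: attached_clique => // H; apply: noc; apply: has_cycle_geq_mono H; lia.
have cL : #|~: K| = m by rewrite /m in Km *; lia.
have nc : ~ has_cycle_geq e' (#|K| + 2).
  by move=> H; apply: noc; apply: has_cycle_geq_mono H; rewrite /m in cL; lia.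
have sumE := sum_deg_clique e's e'i Kcl.
have KE : #|K| = #|G| - m by lia.
have D2 : m * (m + 1) <= \sum_(x in ~: K) (2 * degin e' K x + degin e' (~: K) x).
  by move: D'; rewrite sumE KE leq_add2l.
(* If no summand exceeds [m + 1], the degree sum of the closure is at most the lower bound [D] for
   that of [G], so the closure added no edge. *)
have adjE : {in ~: K, forall x, 2 * degin e' K x + degin e' (~: K) x <= m + 1} ->
    forall x y, adj x y = e' x y.
  move=> le; apply: adj_eq_of_sum_deg => //; apply: leq_trans D; rewrite sumE KE leq_add2l.
  by rewrite -{1}cL -sum_nat_const leq_sum.
pose G' := SGraph e's e'i.
have sub_iso H : isomorphic G' H -> subgraph G H.
  by case=> f /bij_inj fi fE; exists f => // x y /sub; rewrite fE.
have adj_iso H : (forall x y, adj x y = e' x y) -> isomorphic G' H -> isomorphic G H.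
  by move=> eE [f fb fE]; exists f => // x y; rewrite fE eE.
pose W := [set l in ~: K | 1 < degin e' K l].
have [W2|] := ltnP 1 #|W|.
  have [m3 [x [y [xK yK xy Lind Lxy]]]] :=
    extremal_Gamma e's e'i Kcl nc cL D2 W2.
  have xyK : [set x; y] \subset K by apply/subsetP => z; rewrite !inE => /orP[]/eqP->.
  have iso : isomorphic G' (Gamma n m).
    apply: (@isomorphic_join G' [set x; y] (K :\: [set x; y]) (~: K) false) => //.
    - by rewrite cards2 xy.
    - by rewrite cardsD (setIidPr xyK) cards2 xy KE hG.
    - by lia.
    - by rewrite /m; lia.
    - by rewrite -setI_eq0 setIDA setDIl setDv set0I.
    - by rewrite -[X in X :|: _](setIidPr xyK) setID.
    - by rewrite -[X in X :|: _](setIidPr xyK) setID.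
    - by move=> a z aL zxy; rewrite /= Lxy // (subsetP xyK).
    - by move=> a z aL; rewrite inE => /andP[zxy zK]; rewrite /= Lxy // (negbTE zxy).
  (* Each vertex outside [K] contributes 4 to the sum in [D2]. For [k = 1] this is [m + 1], so
     [adjE] gives equality with the closure; for [k = 0] it exceeds [m + 1], and only containment is
     claimed. *)
  right; right; have [k0|k1] : k = 0 \/ k = 1 by rewrite /m in m3; lia.
    by left; split=> //; apply: sub_iso; rewrite /m k0 in iso.
  right; split=> //; rewrite /m k1 in iso; apply: adj_iso => //; apply: adjE => a aL.
  have : degin e' K a <= 2.
    have <- : #|[set x; y]| = 2 by rewrite cards2 xy.
    by apply/subset_leq_card/subsetP => z; rewrite inE => /andP[zK]; rewrite Lxy.
  have : degin e' (~: K) a = 0.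
    apply/eqP; rewrite cards_eq0; apply/eqP/setP => z; rewrite in_set0; apply/negP.
    by rewrite inE => /andP[zL]; rewrite Lind.
  by rewrite /m; lia.
rewrite leq_eqVlt => /orP[/cards1P[l WE]|].
  left; apply: (famF (l |: K)); last exact: attached_one.
  rewrite cardsU1.
  have lK : l \notin K by have := set11 l; rewrite -WE !inE => /andP[].
  by rewrite lK KE hG /m; rewrite /m hG in n1; lia.
rewrite ltnS leqn0 cards_eq0 => /eqP W0; right; left.
have [|v vK [Lcl Lv]] := extremal_L e's e'i Kcl nc cL D2 W0; first by rewrite /m; lia.
apply: adj_iso.
  apply: adjE => a aL; have := degin_le e'i aL; rewrite cL.
  have : degin e' K a <= 1.
    rewrite -(cards1 v); apply/subset_leq_card/subsetP => z.
    by rewrite !inE => /andP[zK]; rewrite Lv.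
  by rewrite /m; lia.
have vsub : [set v] \subset K by rewrite sub1set.
apply: (@isomorphic_join G' [set v] (K :\: [set v]) (~: K) true) => //.
- exact: cards1.
- by rewrite cardsD (setIidPr vsub) cards1 KE hG.
- by rewrite /m in n1; lia.
- by lia.
- by rewrite -setI_eq0 setIDA setDIl setDv set0I.
- by rewrite -[X in X :|: _](setIidPr vsub) setID.
- by rewrite -[X in X :|: _](setIidPr vsub) setID.
- by move=> a z aL; rewrite inE => /eqP->; rewrite /= Lv // eqxx.
- by move=> a z aL; rewrite !inE => /andP[zv zK]; rewrite /= Lv // (negbTE zv).
- move=> a b aL bL /=; have [->|ab] := eqVneq a b; first exact: e'i.
  exact: Lcl.
Qed.
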